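(* Let $X$ be a completely regular space and let $\{H_i:i\in I\}$ be a non-empty collection of ideals in $C_B(X)$. (1) Suppose that $H_i$ is non-vanishing for each $i\in I$. Then $$\mathfrak{sp}\Big(\overline{\bigvee_{i\in I}H_i}\Big)=\bigcup_{i\in I}\mathfrak{sp}\big(\overline{H_i}\big).$$ (2) Suppose that $\bigoplus_{i\in I}H_i$ is non-vanishing (in particular, that this direct sum is defined). Then $$\mathfrak{sp}\Big(\overline{\bigoplus_{i\in I}H_i}\Big)=\bigoplus_{i\in I}\mathfrak{sp}\big(\overline{H_i}\big),$$ where the direct sum on the right is the topological direct sum. (3) Suppose that $\bigcap_{i\in I}H_i$ is non-vanishing. Then $$\mathfrak{sp}\Big(\overline{\bigcap_{i\in I}H_i}\Big)=\mathrm{int}_{\,\mathfrak{sp}(C_B(X))}\Big(\bigcap_{i\in I}\mathfrak{sp}\big(\overline{H_i}\big)\Big).$$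
   Context: Completely regular spaces are assumed to be Hausdorff. $C_B(X)$ is the normed algebra of continuous bounded $f:X\to\mathbb{C}$ with the supremum norm; the bar denotes closure in $C_B(X)$. An ideal $H$ of $C_B(X)$ is non-vanishing if for every $x\in X$ there is $h\in H$ with $h(x)\neq0$. $\bigvee_{i\in I}H_i$ is the ideal $\langle\bigcup_{i\in I}H_i\rangle$ of $C_B(X)$ generated by $\bigcup_{i\in I}H_i$. This ideal is denoted by $\bigoplus_{i\in I}H_i$ provided that $H_i\cap\langle\bigcup_{j\in I,\,j\neq i}H_j\rangle=\{\mathbf{0}\}$ for each $i\in I$. For a closed ideal $K$ of $C_B(X)$, $\mathfrak{sp}(K)$ denotes its Gelfand spectrum (as a commutative $C^*$-algebra), identified with the subspace $\bigcup_{h\in K}\mathrm{cl}_{\beta X}|h|^{-1}((1,\infty))$ of the Stone–Čech compactification $\beta X$; in particular $\mathfrak{sp}(C_B(X))=\beta X$. All equalities are between subspaces of $\beta X$ under this identification. A space $Y$ is the topological direct sum $\bigoplus_{i\in I}Y_i$ of its subspaces $Y_i$ if the $Y_i$ are pairwise disjoint open subspaces of $Y$ whose union is $Y$. *)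

(* Defs.v *)
From HB Require Import structures.
From mathcomp Require Import all_boot all_order all_algebra.
From mathcomp Require Import complex.
From mathcomp Require Import all_classical all_reals all_analysis.

Set Implicit Arguments.
Unset Strict Implicit.
Unset Printing Implicit Defensive.

Import Order.TTheory GRing.Theory Num.Theory.
Import numFieldNormedType.Exports.

Local Open Scope classical_set_scope.
Local Open Scope ring_scope.
Local Open Scope complex_scope.

Section bounded_continuous.
Context (R : realType) (X : topologicalType).
Local Notation C := R[i]^o.

Let ReN (z : C) : (complex.Re `|z|)%:C = `|z|.
Proof. by rewrite RRe_real// normr_real. Qed.

Definition bounded_continuous : {pred X -> C} :=
  mem [set f : X -> C | continuous f /\ bounded_fun f].

Lemma bounded_continuousP (f : X -> C) :
  f \in bounded_continuous <->
  continuous f /\ exists M : R, forall x, `|f x| <= M%:C.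
Proof.
rewrite inE/=; split=> -[cf bf]; split=> //.
  case: bf => M [Mr fM].
  have M1 : M < M + 1 by rewrite ltrDl.
  have := fM _ M1 => /= fM1; exists (complex.Re (M + 1)) => x.
  by rewrite RRe_real ?realD// (le_trans (fM1 x I)).
case: bf => M fM; exists M%:C; split; first by apply/complex_realP; exists M.
by move=> N /ltW MN x _ /=; apply: le_trans (fM x) MN.
Qed.

Lemma bounded_continuous_submod : submod_closed bounded_continuous.
Proof.
split=> [|a f g].
  apply: (bounded_continuousP _).2; split; first by move=> x; exact: cst_continuous.
  by exists 0 => x; rewrite normr0.
move=> /bounded_continuousP[cf [M fM]] /bounded_continuousP[cg [N gN]].
apply: (bounded_continuousP _).2; split.
  by move=> x; apply: cvgD; [apply: cvgZr; exact: cf|exact: cg].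
exists (complex.Re `|a| * M + N) => x.
rewrite rmorphD rmorphM [X in X * _]ReN.
apply: le_trans (ler_normD _ _) _; rewrite lerD//.
by rewrite normrZ ler_wpM2l.
Qed.

Lemma bounded_continuous_mulr : mulr_closed bounded_continuous.
Proof.
split=> [|f g].
  apply: (bounded_continuousP _).2; split; first by move=> x; exact: cst_continuous.
  by exists 1 => x; rewrite normr1.
move=> /bounded_continuousP[cf [M fM]] /bounded_continuousP[cg [N gN]].
apply: (bounded_continuousP _).2; split.
  by move=> x; apply: (@cvgM R[i] X); [exact: cf|exact: cg].
exists (M * N) => x.
by rewrite rmorphM /= normrM ler_pM.
Qed.

HB.instance Definition _ := GRing.isSubmodClosed.Build R[i] (X -> C)
  bounded_continuous bounded_continuous_submod.
HB.instance Definition _ := GRing.isMulClosed.Build (X -> C)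
  bounded_continuous bounded_continuous_mulr.

(* The algebra of bounded continuous complex functions on X; its norm is the
   supremum norm, which is 0 when X is empty, see [CB_normE]. *)
Record CB := MkCB {
  CB_fun :> X -> C ;
  CB_funP : CB_fun \in bounded_continuous }.

HB.instance Definition _ := [isSub for CB_fun].
HB.instance Definition _ := gen_eqMixin CB.
HB.instance Definition _ := gen_choiceMixin CB.
HB.instance Definition _ := [SubChoice_isSubLmodule of CB by <:].
HB.instance Definition _ :=
  GRing.SubZmodule_isSubPzRing.Build _ _ CB (subringClosedP _).
HB.instance Definition _ := GRing.SubPzRing_isSubComPzRing.Build _ _ CB.

Lemma CB_bounded (f : CB) : exists M : R, forall x, `|f x| <= M%:C.
Proof. by have /bounded_continuousP[] := CB_funP f. Qed.

Definition CB_norm (f : CB) : R := sup [set complex.Re `|f x| | x in [set: X]].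

Lemma le_CB_norm (f : CB) x : `|f x| <= (CB_norm f)%:C.
Proof.
rewrite -ReN lecR; apply: ub_le_sup; last by exists x.
have [M fM] := CB_bounded f; exists M => _ [y _ <-].
by rewrite -lecR ReN fM.
Qed.

Lemma CB_norm_ge0 (f : CB) : 0 <= CB_norm f.
Proof.
have [[x _]|X0] := pselect ([set: X] !=set0).
  by rewrite -lecR; apply: le_trans (le_CB_norm f x); exact: normr_ge0.
rewrite /CB_norm (_ : [set _ | _ in _] = set0) ?sup0//.
by apply/seteqP; split=> // r [x _ _]; apply: X0; exists x.
Qed.

Lemma CB_norm_le (f : CB) (M : R) :
  0 <= M -> (forall x, `|f x| <= M%:C) -> CB_norm f <= M.
Proof.
move=> M0 fM; rewrite /CB_norm; set A := [set _ | _ in _].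
have [->|/set0P A0] := eqVneq A set0; first by rewrite sup0.
by apply: ge_sup => // _ [x _ <-]; rewrite -lecR ReN.
Qed.

Let CB_normD (f g : CB) :
  (CB_norm (f + g))%:C <= (CB_norm f)%:C + (CB_norm g)%:C.
Proof.
rewrite -rmorphD/= lecR; apply: CB_norm_le => [|x].
  by rewrite addr_ge0 ?CB_norm_ge0.
rewrite rmorphD/=; apply: le_trans (ler_normD _ _) _.
by rewrite lerD ?le_CB_norm.
Qed.

Let CB_normZ (a : R[i]) (f : CB) :
  (CB_norm (a *: f))%:C = `|a| * (CB_norm f)%:C.
Proof.
have le_normZ b (h : CB) : (CB_norm (b *: h))%:C <= `|b| * (CB_norm h)%:C.
  rewrite -[`|b|]ReN -rmorphM lecR; apply: CB_norm_le => [|x].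
    by rewrite mulr_ge0 ?CB_norm_ge0// -lecR ReN; exact: normr_ge0.
  by rewrite rmorphM/= ReN normrZ ler_wpM2l ?le_CB_norm.
apply/eqP; rewrite eq_le le_normZ /=.
have [->|a0] := eqVneq a 0.
  by rewrite normr0 mul0r (lecR 0) CB_norm_ge0.
have := le_normZ a^-1 (a *: f).
by rewrite scalerA mulVf// scale1r normfV ler_pdivlMl ?normr_gt0.
Qed.

Let CB_norm0_eq0 (f : CB) : (CB_norm f)%:C = 0 -> f = 0.
Proof.
move=> f0; apply/val_inj/funext => x; apply/eqP.
by rewrite -normr_le0 -f0 le_CB_norm.
Qed.

HB.instance Definition _ :=
  Lmodule_isNormed.Build R[i] CB CB_normD CB_normZ CB_norm0_eq0.

Lemma CB_normE (f : CB) : `|f| = (CB_norm f)%:C.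
Proof. by []. Qed.

Lemma closure_CBP (A : set CB) (f : CB) :
  closure A f <->
  forall eps : R, 0 < eps -> exists2 h, A h & CB_norm (f - h) < eps.
Proof.
split=> [fA eps eps0|fA B].
  have [|h [Ah]] := fA (ball f eps%:C).
    by apply: nbhsx_ballx; rewrite (ltcR 0).
  by rewrite -ball_normE /= CB_normE ltcR; exists h.
move=> /nbhs_ballP[_ /posnumP[r] rB].
have r0 : (complex.Re r%:num)%:C = r%:num by rewrite RRe_real// ger0_real.
have Rr0 : 0 < complex.Re r%:num by rewrite -ltcR r0; exact: gt0.
have [h Ah fh] := fA _ Rr0.
exists h; split=> //; apply: rB.
by rewrite -ball_normE /= CB_normE -r0 ltcR.
Qed.

End bounded_continuous.

Section ideals.
Context (R : realType) (X : topologicalType).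
Implicit Types H A : set (CB R X).

(* Ideals need not be proper, unlike those of [idealr_closed]. *)
Definition ideal H :=
  [/\ H 0,
      forall f g, H f -> H g -> H (f + g) &
      forall f g, H g -> H (f * g)].

Definition ideal_gen A := smallest ideal A.

Definition non_vanishing H := forall x, exists2 h, H h & h x != 0.

Definition ideal_join (I : Type) (F : I -> set (CB R X)) :=
  ideal_gen (\bigcup_i F i).

(* The condition under which [ideal_join F] is called the direct sum of F. *)
Definition ideal_direct (I : Type) (F : I -> set (CB R X)) :=
  forall i, F i `&` ideal_gen (\bigcup_(j in [set j | j <> i]) F j) = [set 0].

End ideals.

Definition topological_embedding (X Y : topologicalType) (e : X -> Y) :=
  [/\ continuous e, injective e &
      forall U : set X, open U -> exists2 V : set Y, open V & e @^-1` V = U].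

Definition compactification (X bX : topologicalType) (e : X -> bX) :=
  [/\ compact [set: bX], hausdorff_space bX,
      topological_embedding e & dense (range e)].

Definition stone_cech (X bX : topologicalType) (e : X -> bX) :=
  compactification e /\
  forall (K : topologicalType) (f : X -> K),
    compact [set: K] -> hausdorff_space K -> continuous f ->
    exists2 g : bX -> K, continuous g & g \o e = f.

Section spectrum.
Context (R : realType) (X bX : topologicalType) (e : X -> bX).

(* The Gelfand spectrum of a closed ideal K of CB R X, as a subspace of the
   Stone-Cech compactification e : X -> bX: a point p is identified with the
   character of K sending h to the value at p of the extension of h to bX, and
   the points at which this character is nonzero are exactly those below. *)
Definition sp (K : set (CB R X)) : set bX :=
  \bigcup_(h in K) closure (e @` [set x | 1 < `|h x|]).

Lemma sp_setT : dense (range e) -> sp setT = setT.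
Proof.
move=> de; apply/seteqP; split=> // p _; exists (1 + 1) => // B pB.
have [y [/= By [x _ exy]]] := de _ (ex_intro _ p pB) (open_interior B).
exists y; split; last exact: interior_subset.
exists x => //=.
suff : 1 < `|1 + 1 : R[i]| by [].
by rewrite ger0_norm ?addr_ge0// ltrDl.
Qed.

End spectrum.

(* Y is the topological direct sum of its subspaces F i. *)
Definition topological_direct_sum (T : topologicalType) (I : Type)
    (Y : set T) (F : I -> set T) :=
  [/\ Y = \bigcup_i F i, trivIset setT F &
      forall i, open (F i : set (subspace Y))].

(* Main.v *)
(* For p in bX, the functions of CB R X tending to 0 along e at p form an ideal,
   and p lies outside the spectrum of (the closure of) an ideal K exactly when K
   is contained in it; this gives (1).  Since bX is the Stone-Cech
   compactification, |h| stays above 1/2 near every p adherent to {|h| > 1}.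
   Hence spectra are open, and ideals with zero product have disjoint spectra,
   which gives (2).  For (3), let p be interior to the intersection of the
   spectra and let l be an Urysohn function on bX, equal to 2 at p and
   vanishing off a compact subset D of that intersection.  By compactness each
   H i contains some g >= 0 with g >= 1 on D, hence contains l \o e as a
   multiple of g. *)

Require Import Defs.
From mathcomp Require Import all_boot all_order all_algebra.
From mathcomp Require Import complex.
From mathcomp Require Import all_classical all_reals all_analysis.
From mathcomp Require Import lra.

Import Order.TTheory GRing.Theory Num.Theory.
Import numFieldNormedType.Exports.

Local Open Scope classical_set_scope.

(** * Moduli of complex numbers as real numbers, and continuity *)

Section complex_topology.
Set Implicit Arguments.
Unset Strict Implicit.
Local Open Scope ring_scope.
Local Open Scope complex_scope.
Context (R : realType).
Local Notation C := R[i]^o.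

(** Norms on [R[i]] take values in [R[i]] itself; this identity moves estimates to the totally
    ordered field [R]. *)
Lemma Re_normcK (z : C) : (complex.Re `|z|)%:C = `|z|.
Proof. by rewrite RRe_real// normr_real. Qed.

Lemma Re_normc_ge0 (z : C) : 0 <= complex.Re `|z|.
Proof. by rewrite -lecR Re_normcK normr_ge0. Qed.

Lemma Re_normcM (z w : C) :
  complex.Re `|z * w| = complex.Re `|z| * complex.Re `|w|.
Proof. by apply: complexI; rewrite rmorphM/= !Re_normcK normrM. Qed.

Lemma norm_real_complex (r : R) : `|r%:C : C| = `|r|%:C.
Proof. by rewrite normc_def /= expr0n addr0 sqrtr_sqr. Qed.

Lemma Re_normc_real (r : R) : complex.Re `|r%:C : C| = `|r|.
Proof. by rewrite norm_real_complex. Qed.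

Lemma continuous_Re_normc : continuous (fun z : C => complex.Re `|z|).
Proof.
move=> a A /nbhs_ballP[eps /= eps0 epsA].
apply/nbhs_ballP; exists eps%:C => [|b]; rewrite /= ?(ltcR 0)// => ab.
apply: epsA; rewrite -ball_normE/= -ltcR -norm_real_complex rmorphB/= !Re_normcK.
by apply: le_lt_trans (ler_dist_dist _ _) _; move: ab; rewrite -ball_normE.
Qed.

Lemma continuous_real_complex : continuous (fun r : R => r%:C : C).
Proof.
move=> a A /nbhs_ballP[eps /= eps0 epsA].
have epsE : (complex.Re eps)%:C = eps by rewrite RRe_real// ger0_real// ltW.
apply/nbhs_ballP; exists (complex.Re eps) => [|b /=].
  by rewrite /= -ltcR epsE.
rewrite -ball_normE/= -ltcR epsE -norm_real_complex rmorphB => ab.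
by apply: epsA; rewrite -ball_normE.
Qed.

Lemma continuous_conjc : continuous (@conjc R : C -> C).
Proof.
move=> a A /nbhs_ballP[eps /= eps0 epsA].
apply/nbhs_ballP; exists eps => // b.
by rewrite -ball_normE/= -normcJ rmorphB => ab; apply: epsA; rewrite -ball_normE.
Qed.

End complex_topology.

(** * Construction of elements and ideals of [CB R X] *)

Section real_valued.
Set Implicit Arguments.
Unset Strict Implicit.
Local Open Scope ring_scope.
Local Open Scope complex_scope.
Context (R : realType) (X : topologicalType).
Local Notation C := R[i]^o.
Implicit Types (f g h : CB R X) (K : set (CB R X)).

Lemma CB_of_continuous (r : X -> C) (M : R) : continuous r ->
  (forall x, complex.Re `|r x| <= M) -> exists f, forall x, f x = r x.
Proof.
move=> cr rM; have rP : r \in @bounded_continuous R X.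
  apply/bounded_continuousP; split=> //; exists M => x.
  by rewrite -Re_normcK lecR.
by exists (MkCB rP).
Qed.

Lemma CB_of_real (r : X -> R) (M : R) : continuous r ->
  (forall x, `|r x| <= M) -> exists f, forall x, f x = (r x)%:C.
Proof.
move=> cr rM; apply: (@CB_of_continuous _ M) => [x|x].
  by apply: continuous_comp; [exact: cr|exact: continuous_real_complex].
by rewrite Re_normc_real.
Qed.

Lemma CB_continuous f : continuous f.
Proof. by have /bounded_continuousP[] := CB_funP f. Qed.

Lemma CB_continuous_norm f : continuous (fun x => complex.Re `|f x|).
Proof.
by move=> x; apply: continuous_comp;
  [exact: CB_continuous|exact: continuous_Re_normc].
Qed.

Lemma CB_bounded_norm f : exists M : R, forall x, complex.Re `|f x| <= M.
Proof. by have [M fM] := CB_bounded f; exists M => x; rewrite -lecR Re_normcK. Qed.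

Lemma CB_conj h : exists f, forall x, f x = (h x)^*%C.
Proof.
have [M hM] := CB_bounded_norm h.
apply: (@CB_of_continuous _ M) => x; last by rewrite normcJ.
by apply: continuous_comp; [exact: CB_continuous|exact: continuous_conjc].
Qed.

Lemma CB_const (c : C) : exists f, forall x, f x = c.
Proof.
by apply: (@CB_of_continuous _ (complex.Re `|c|)) => // x; exact: cst_continuous.
Qed.

Lemma CB_addE f g x : (f + g) x = f x + g x. Proof. by []. Qed.
Lemma CB_mulE f g x : (f * g) x = f x * g x. Proof. by []. Qed.

Lemma ideal_gen_ideal (A : set (CB R X)) : ideal (ideal_gen A).
Proof.
split=> [B [[B0 _ _] _]//|f g Af Ag B /= BP|f g Ag B /= BP].
  by have [[_ BD _] _] := BP; apply: BD; [exact: Af|exact: Ag].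
by have [[_ _ BM] _] := BP; apply: BM; exact: Ag.
Qed.

Lemma ideal_bigcap (I : Type) (H : I -> set (CB R X)) :
  (forall i, ideal (H i)) -> ideal (\bigcap_i H i).
Proof.
move=> iH; split=> [i _|f g Hf Hg i _|f g Hg i _]; have [H0 HD HM] := iH i => //.
- by apply: HD; [exact: Hf|exact: Hg].
- by apply: HM; exact: Hg.
Qed.

End real_valued.

(** * Spectra described by functions vanishing at a point of [bX] *)

Section spectrum.
Set Implicit Arguments.
Unset Strict Implicit.
Local Open Scope ring_scope.
Local Open Scope complex_scope.
Context (R : realType) (X bX : topologicalType) (e : X -> bX).
Local Notation C := R[i]^o.
Implicit Types (f g h : CB R X) (K : set (CB R X)).

Lemma closure_imageP (A : set X) p :
  closure (e @` A) p <-> forall V, nbhs p V -> exists2 x, A x & V (e x).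
Proof.
split=> [clA V /clA[_ [[x Ax <-] Vx]]|clA V /clA[x Ax Vx]]; first by exists x.
by exists (e x); split=> //; exists x.
Qed.

Lemma ltc_norm (a : R) (z : C) : (a%:C < `|z|) = (a < complex.Re `|z|).
Proof. by rewrite -Re_normcK ltcR. Qed.

(* The kernel of the character of CB R X at p, described without extending the
   functions to bX. *)
Definition vanishing_at (p : bX) : set (CB R X) :=
  [set h | forall eps : R, 0 < eps ->
    exists2 V, nbhs p V & forall x, V (e x) -> complex.Re `|h x| < eps].

Lemma vanishing_at_ideal p : ideal (vanishing_at p).
Proof.
split=> [eps eps0|f g f0 g0 eps eps0|f g g0 eps eps0].
- exists setT; first exact: filterT.
  by move=> x _; rewrite [X in `|X|](_ : _ = 0)// normr0.
- have eps20 : 0 < eps / 2 by rewrite divr_gt0.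
  have [V pV fV] := f0 _ eps20; have [W pW gW] := g0 _ eps20.
  exists (V `&` W); first exact: filterI.
  move=> x [/fV fx /gW gx]; have : complex.Re `|(f + g) x| <=
      complex.Re `|f x| + complex.Re `|g x|.
    by rewrite -lecR rmorphD/= !Re_normcK; exact: ler_normD.
  lra.
- have [M fM] := CB_bounded_norm f.
  (* The bound [M] may be zero, or negative if [X] is empty; [|M| + 1] is a positive bound in every
     case. *)
  have [V pV gV] := g0 (eps / (`|M| + 1)) ltac:(by rewrite divr_gt0// ltr_wpDl).
  exists V => // x /gV gx; rewrite CB_mulE Re_normcM.
  have M0 : 0 < `|M| + 1 by rewrite ltr_wpDl.
  apply: (@le_lt_trans _ _ ((`|M| + 1) * complex.Re `|g x|)).
    rewrite ler_wpM2r ?Re_normc_ge0// (le_trans (fM x))//.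
    by rewrite (le_trans (ler_norm _))// lerDl.
  by rewrite mulrC -ltr_pdivlMr.
Qed.

(** Some [g] in [K] is within 1/2 of the witness [h], so [|g| > 1/2] at points arbitrarily close to
    [p] with [|h| > 1], and [g] does not tend to 0 there. *)
Lemma sp_closure_nonvanishing K p :
  sp e (closure K) p -> ~ K `<=` vanishing_at p.
Proof.
move=> [h Kh /closure_imageP hp] Kp.
have [|g /Kp pg hg] := (closure_CBP K h).1 Kh 2^-1; first by rewrite invr_gt0.
have [|V pV gV] := pg 2^-1; first by rewrite invr_gt0.
have [x /= + /gV gx] := hp V pV; rewrite ltc_norm => hx.
have : complex.Re `|h x| <= CB_norm (h - g) + complex.Re `|g x|.
  rewrite -lecR rmorphD/= !Re_normcK -[X in `|X| <= _](subrK (g x)).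
  apply: (le_trans (ler_normD _ _)); rewrite lerD2r.
  exact: (le_CB_norm (h - g) x).
lra.
Qed.

(** If [|h| >= eps] at points arbitrarily close to [p], the multiple [(2 / eps) * h] has modulus at
    least 2, hence above 1, at those points. *)
Lemma nonvanishing_sp K p : ideal K -> ~ K `<=` vanishing_at p -> sp e K p.
Proof.
move=> [_ _ KM].
move=> /existsNP[h /not_implyP[Kh /existsNP[eps /not_implyP[eps0 hp]]]].
have [c cE] := CB_const X ((2 / eps)%:C : C).
exists (c * h); first exact: KM.
apply/closure_imageP => V pV; apply: contrapT => Vh; apply: hp.
exists V => // x Vx; rewrite ltNge; apply/negP => hx; apply: Vh; exists x => //.
rewrite /mkset ltc_norm CB_mulE Re_normcM cE Re_normc_real gtr0_norm ?divr_gt0//.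
by rewrite mulrAC ltr_pdivlMr// mul1r; lra.
Qed.

Lemma sp_closureE K : ideal K -> sp e (closure K) = sp e K.
Proof.
move=> iK; apply/seteqP; split=> [p /sp_closure_nonvanishing|p [h Kh hp]].
  exact: nonvanishing_sp.
by exists h => //; exact: subset_closure.
Qed.

Lemma spP K p : ideal K -> sp e K p <-> ~ K `<=` vanishing_at p.
Proof.
move=> iK; split; last exact: nonvanishing_sp.
by rewrite -sp_closureE//; exact: sp_closure_nonvanishing.
Qed.

(** Since [vanishing_at p] is an ideal, it contains the join as soon as it contains every [H i]. *)
Lemma sp_ideal_join (I : Type) (H : I -> set (CB R X)) :
  (forall i, ideal (H i)) -> sp e (ideal_join H) = \bigcup_i sp e (H i).
Proof.
move=> iH; apply/seteqP; split=> [p|p [i _ [h Hh hp]]]; last first.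
  by exists h => // B [_]; apply; exists i.
move=> /(spP _ (ideal_gen_ideal _)) Hp; apply: contrapT => nHp; apply: Hp.
apply: smallest_sub; first exact: vanishing_at_ideal.
move=> h [i _ Hh]; apply: contrapT => hp; apply: nHp; exists i => //.
by apply/spP => // /(_ _ Hh).
Qed.

(** * Openness and disjointness of spectra in the Stone-Cech compactification *)

Hypothesis e_stone_cech : stone_cech e.

Let e_continuous : continuous e.
Proof. by have [[_ _ []]] := e_stone_cech. Qed.

Let e_dense : dense (range e).
Proof. by have [[]] := e_stone_cech. Qed.

(** The extension of [r] to [bX] must take the value [c] at [p], by adherence to [A]; the preimage
    of a ball around [c] is then the required neighbourhood. *)
Lemma stone_cech_near (r : X -> R) (A : set X) (c eps : R) p :
  continuous r -> 0 < eps -> (forall x, A x -> r x = c) -> closure (e @` A) p ->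
  exists2 V, open_nbhs p V & forall x, V (e x) -> `|c - r x| < eps.
Proof.
move=> cr eps0 rA /closure_imageP Ap.
(* A compact Hausdorff target for r that needs no bound on r. *)
pose K := one_point_compactification R.
have hK : hausdorff_space K.
  apply: one_point_compactification_hausdorff; last exact: Rhausdorff.
  exact: locally_compactR.
have [|s cs sE] := e_stone_cech.2 K (Some \o r)
  one_point_compactification_compact hK.
  by move=> x; apply: continuous_comp; [exact: cr|
    exact: one_point_compactification_some_continuous].
have seE x : s (e x) = Some (r x) by rewrite -[LHS]/((s \o e) x) sE.
have sp : s p = Some c.
  (* A point of [A] close to [p] is sent near [s p] and exactly to [Some c], so these two points
     cannot be separated in [K]. *)
  apply: hK => U W sU cW.
  have [x Ax Ux] := Ap _ (cs _ _ sU).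
  exists (s (e x)); split=> //.
  by rewrite seE rA//; exact: nbhs_singleton cW.
exists (s @^-1` (Some @` ball c eps)).
  split; last by rewrite /= sp; exists c => //; exact: ballxx.
  apply: open_comp; first by move=> x _; exact: cs.
  by apply: one_point_compactification_open_some; exact: ball_open.
by move=> x /=; rewrite seE => -[y + [<-]]; rewrite -ball_normE.
Qed.

(** Truncating [|h|] at 1 makes it constant on the set where [|h| > 1], as [stone_cech_near]
    demands. *)
Lemma closure_level_nbhs h p : closure (e @` [set x | 1 < `|h x|]) p ->
  exists2 V, open_nbhs p V & forall x, V (e x) -> 2^-1 < complex.Re `|h x|.
Proof.
pose r x := Num.min (complex.Re `|h x|) 1.
have cr : continuous r.
  move=> x; apply: (@continuous_min R X (fun x => complex.Re `|h x|) (cst 1)).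
    exact: CB_continuous_norm.
  exact: cst_continuous.
move=> /(@stone_cech_near r _ 1 2^-1 p cr) []; first by rewrite invr_gt0.
  by move=> x /=; rewrite ltc_norm /r => hx; apply/min_idPr/ltW.
move=> V pV rV; exists V => // x /rV; rewrite ltr_distlC /r => /andP[+ _].
by rewrite lt_min => /andP[+ _]; lra.
Qed.

Lemma dense_nbhs (p : bX) (V : set bX) : nbhs p V -> exists x, V (e x).
Proof.
move=> pV; have [] := e_dense (O := V^°).
- by exists p.
- exact: open_interior.
by move=> y [/interior_subset Vy [x _ xE]]; exists x; rewrite xE.
Qed.

(** One [h] serves for a whole neighbourhood [V] of [p]: [|h| > 1/2] on the trace of [V], and by
    density this trace accumulates at each [q] in [V]. *)
Lemma open_sp K : ideal K -> open (sp e K).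
Proof.
move=> iK; rewrite openE => p [h Kh hp].
have [V [oV Vp] hV] := closure_level_nbhs hp.
rewrite /interior nbhsE; exists V => // q Vq.
apply/spP => // /(_ _ Kh 2^-1)[|W qW hW]; first by rewrite invr_gt0.
have [x [/hV Vx /hW]] := dense_nbhs (filterI (open_nbhs_nbhs (conj oV Vq)) qW).
lra.
Qed.

(** At a common point, [|f| > 1/2] throughout a neighbourhood that also contains a point with
    [|g| > 1], where [f * g] cannot vanish. *)
Lemma sp_disjoint K1 K2 p : (forall f g, K1 f -> K2 g -> f * g = 0) ->
  sp e K1 p -> sp e K2 p -> False.
Proof.
move=> K12 [f Kf /closure_level_nbhs[V pV fV]] [g Kg /closure_imageP gp].
have [x /= + /fV fx] := gp V (open_nbhs_nbhs pV).
rewrite ltc_norm => gx; have : (f * g) x = 0 by rewrite (K12 f g).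
rewrite CB_mulE => /(congr1 (fun z : C => complex.Re `|z|)).
rewrite Re_normcM normr0 => /eqP; rewrite mulf_eq0 => /orP[]/eqP.
  by move=> f0; move: fx; rewrite f0; lra.
by move=> g0; move: gx; rewrite g0; lra.
Qed.

(** * Intersections of ideals, through positive elements and Urysohn functions *)

Lemma ideal_norm2 K h : ideal K -> K h ->
  exists2 g, K g & forall x, g x = (complex.Re `|h x| ^+ 2)%:C.
Proof.
move=> [_ _ KM] Kh; have [k kE] := CB_conj h.
exists (k * h); first exact: KM.
by move=> x; rewrite CB_mulE kE rmorphXn/= Re_normcK sqr_normc mulrC.
Qed.

Lemma ideal_bounded_below K (D : set bX) : ideal K -> compact D ->
  D `<=` sp e K ->
  exists2 g, K g & exists2 r : X -> R, (forall x, g x = (r x)%:C) &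
    (forall x, 0 <= r x) /\ (forall x, D (e x) -> 1 <= r x).
Proof.
move=> iK cD DK; have [K0 KD KM] := iK.
pose P (V : set bX) := exists2 g, K g &
  exists2 r : X -> R, (forall x, g x = (r x)%:C) &
    (forall x, 0 <= r x) /\ (forall x, V (e x) -> 1 <= r x).
have P0 : P set0 by exists 0 => //; exists (fun=> 0).
(* Adding nonnegative functions preserves each lower bound 1, which makes [P] directed. *)
have PU V W : P V -> P W -> P (V `|` W).
  move=> [g Kg [r gE [r0 r1]]] [g' Kg' [r' gE' [r0' r1']]].
  exists (g + g'); first exact: KD.
  exists (fun x => r x + r' x) => [x|]; first by rewrite CB_addE gE gE' rmorphD.
  split=> x; first by rewrite addr_ge0.
  by move=> [Vx|Wx]; [rewrite ler_wpDr// r1|rewrite ler_wpDl// r1'].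
(* [compact_cover] requires bX to be pointed, so compactness is used through the
   filter generated by the upper sets of the directed family P. *)
pose F := filter_from P (fun V => [set W | V `<=` W]).
have FF : Filter F.
  apply: filter_from_filter; first by exists set0.
  move=> V W PV PW; exists (V `|` W); first exact: PU.
  by move=> U VWU; split=> q ?; apply: VWU; [left|right].
suff : \forall V \near F, D `<=` V.
  case=> V PV VD; have DV : D `<=` V by exact: VD.
  have [g Kg [r gE [r0 r1]]] := PV; exists g => //; exists r => //; split=> // x.
  by move=> /DV; exact: r1.
(* With membership as the relation, it suffices that each point of [D] has a neighbourhood
   satisfying [P]. *)
move/compact_near_coveringP : cD => /(_ _ F (fun V q => V q) FF); apply=> p.
move=> /DK[h Kh hp]; have [V pV hV] := closure_level_nbhs hp.
suff PV : P V.
  exists (V, [set W | V `<=` W]) => /=; last by move=> [q W] [/= Vq VW]; exact: VW.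
  by split; [exact: open_nbhs_nbhs|exists V].
(* The factor 2 raises the bound [|h| > 1/2] on [V] to 1, which squaring preserves. *)
have [c cE] := CB_const X (2%:R%:C : C).
have [g Kg gE] := ideal_norm2 iK (KM c _ Kh).
exists g => //; exists (fun x => complex.Re `|(c * h) x| ^+ 2) => //.
split=> x; first by rewrite sqr_ge0.
move=> /hV hx; rewrite exprn_ege1// CB_mulE Re_normcM cE Re_normc_real.
by rewrite ger0_norm//; lra.
Qed.

(** The quotient [f / max(r, 1)] is bounded and continuous, and its product with [g] is [f], because
    [max(r, 1) = r] wherever [f] is nonzero. *)
Lemma ideal_of_support K g f (r : X -> R) : ideal K -> K g ->
  (forall x, g x = (r x)%:C) -> (forall x, 0 <= r x) ->
  (forall x, f x != 0 -> 1 <= r x) -> K f.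
Proof.
move=> [_ _ KM] Kg gE r0 r1.
pose m x := Num.max (r x) 1.
have m1 x : 1 <= m x by rewrite le_max lexx orbT.
have m0 x : 0 < m x by rewrite (lt_le_trans ltr01).
(* Continuity of [r] is inherited from [g], since [r = |g|]. *)
have rE : r = fun x => complex.Re `|g x|.
  by apply/funext => x; rewrite gE Re_normc_real ger0_norm.
have cm : continuous m.
  move=> x; apply: (@continuous_max R X r (cst 1)); last exact: cst_continuous.
  by rewrite rE; exact: CB_continuous_norm.
have [||v vE] := @CB_of_real R X (fun x => (m x)^-1) 1.
- by move=> x; apply: cvgV; [rewrite gt_eqF|exact: cm].
- by move=> x; rewrite gtr0_norm ?invr_gt0// invf_le1.
suff -> : f = f * v * g by exact: KM.
apply/val_inj/funext => x /=.
have [fx0|/r1 rx1] := eqVneq (f x) 0.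
  by rewrite -[RHS]/(f x * v x * g x) fx0 !mul0r.
rewrite -[RHS]/(f x * v x * g x) vE gE -mulrA -rmorphM/= /m.
by rewrite (max_idPl rx1) mulVf ?mulr1// gt_eqF// (lt_le_trans ltr01).
Qed.

Lemma interior_bigcap_sp (I : Type) (H : I -> set (CB R X)) :
  (forall i, ideal (H i)) ->
  interior (\bigcap_i sp e (H i)) `<=` sp e (\bigcap_i H i).
Proof.
move=> iH p Up; set U := (_^°) in Up.
have [[cptb hb _ _] _] := e_stone_cech.
have oU : open U by exact: open_interior.
have /(@uniform_separatorP _ R)[k [ck k01 kp kU]] :
    uniform_separator [set p] (~` U).
  have := @normal_completely_regular R bX (compact_normal hb cptb).
  move=> /(_ (hausdorff_accessible hb)); apply; first exact: open_closedC.
  by move=> /(_ Up).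
have {}kp : k p = 0 by apply: kp; exists p.
have {}kU q : k q < 1 -> U q.
  apply: contraPP => Uq; suff -> : k q = 1 by rewrite ltxx.
  by apply: kU; exists q.
have {}k01 q : 0 <= k q <= 1.
  by have /= := k01 (k q) (imageT k q); rewrite in_itv.
(* [l] is 2 at [p], exceeds 1 where [k < 1/4], and vanishes where [k >= 1/2]. *)
pose l q := Num.max (2 - 4 * k q) 0.
have l0 q : 0 <= l q by rewrite le_max lexx orbT.
have cl : continuous l.
  move=> q; apply: (@continuous_max R bX (fun q => 2 - 4 * k q) (cst 0)).
    apply: cvgB; first exact: cvg_cst.
    by apply: cvgM; [exact: cvg_cst|exact: ck].
  exact: cst_continuous.
have [||f fE] := @CB_of_real R X (l \o e) 2.
- by move=> x; apply: continuous_comp; [exact: e_continuous|exact: cl].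
- move=> x; rewrite ger0_norm//= ge_max ler0n andbT.
  by have := k01 (e x); lra.
exists f.
  (* This closed, hence compact, set contains the support of [l] and lies in [U], where [k < 1]
     suffices for membership. *)
  move=> i _; pose D := k @^-1` [set s | s <= 2^-1].
  have cD : compact D.
    apply: (subclosed_compact _ cptb) => //.
    by apply: closed_comp => [q _|]; [exact: ck|exact: closed_le].
  have [|g Hg [r gE [r0 r1]]] := ideal_bounded_below (iH i) cD.
    move=> q Dq; have /interior_subset : U q.
      by apply: kU; move: Dq; rewrite /D/=; lra.
    exact.
  apply: (ideal_of_support (iH i) Hg gE r0) => x; rewrite fE => fx; apply: r1.
  rewrite /D /= leNgt; apply: contra fx => kx.
  by rewrite /= /l (max_idPr _)//; lra.
apply/closure_imageP => V pV.
have pk : nbhs p (k @^-1` [set s | s < 4^-1]).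
  apply: ck; rewrite kp; apply: open_nbhs_nbhs; split; first exact: open_lt.
  by rewrite /= invr_gt0.
have [x [Vx kx]] := dense_nbhs (filterI pV pk); exists x => //=.
rewrite ltc_norm fE Re_normc_real ger0_norm//= /l lt_max; apply/orP; left.
by move: kx; rewrite /=; lra.
Qed.

End spectrum.

(** * Spectra of joins, direct sums and intersections *)

Theorem theorem3p2p13 (R : realType) (X bX : topologicalType) (e : X -> bX)
    (X_completely_regular : completely_regular_space X)
    (X_hausdorff : hausdorff_space X)
    (e_stone_cech : stone_cech e)
    (I : Type) (I_nonempty : inhabited I)
    (H : I -> set (CB R X)) (H_ideal : forall i, ideal (H i)) :
  [/\ (forall i, non_vanishing (H i)) ->
        sp e (closure (ideal_join H)) = \bigcup_i sp e (closure (H i)),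
      ideal_direct H -> non_vanishing (ideal_join H) ->
        topological_direct_sum (sp e (closure (ideal_join H)))
          (fun i => sp e (closure (H i))) &
      non_vanishing (\bigcap_i H i) ->
        sp e (closure (\bigcap_i H i)) =
        interior (\bigcap_i sp e (closure (H i)))].
Proof.
have spE : (fun i => sp e (closure (H i))) = (fun i => sp e (H i)).
  by apply/funext => i; rewrite sp_closureE.
have joinE : sp e (closure (ideal_join H)) = \bigcup_i sp e (closure (H i)).
  by rewrite spE sp_closureE ?sp_ideal_join//; exact: ideal_gen_ideal.
split=> [_|dH _|_]; first exact: joinE.
- split=> [//||i].
    rewrite spE => i j _ _ [p [pi pj]]; apply: contrapT => ij.
    apply: (sp_disjoint e_stone_cech _ pi pj) => f g Hf Hg.
    (* A product of elements of [H i] and [H j] lies in both ideals, so directness forces it to be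
       0. *)
    suff : (H i `&` ideal_gen (\bigcup_(j in [set j | j <> i]) H j)) (f * g)%R.
      by rewrite dH.
    have [_ _ HiM] := H_ideal i; have [_ _ HjM] := H_ideal j.
    split; first by rewrite mulrC; exact: HiM.
    by move=> B [_ HB]; apply: HB; exists j; [exact/nesym|exact: HjM].
  by apply: open_subspaceW; rewrite sp_closureE//; exact: open_sp.
- rewrite spE sp_closureE; last exact: ideal_bigcap.
  apply/seteqP; split; last exact: interior_bigcap_sp.
  (* An open set lies in the interior once it lies in the intersection, and a witness from the
     intersection of the [H i] serves for every [i]. *)
  rewrite -open_subsetE; last by apply: open_sp => //; exact: ideal_bigcap.
  by move=> p [h Hh hp] i _; exists h => //; exact: Hh.
Qed.
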